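(* Let $G=(V,E)$ be an infinite, locally finite, connected, vertex-transitive, simple graph with degree $\Delta\ge 3$. Let $P$ be the transition matrix of simple random walk on $G$, and let $\lambda$ be the spectral bottom of $I-P$. Then the connective constant $\mu(G)$ satisfies $$\mu(G)\ \ge\ (\Delta-1)^{\frac12(1+c\lambda)},\qquad\text{where } c=\frac{\Delta(\Delta-1)}{(\Delta-2)^2}.$$
   Context: Connective constant: an $n$-step self-avoiding walk on $G$ is a walk with $n$ edges that visits no vertex more than once. Let $\sigma_n$ be the number of $n$-step self-avoiding walks on $G$ starting at a fixed vertex $\mathbf 1$ (by transitivity the choice is immaterial). The connective constant is $\mu(G)=\lim_{n\to\infty}\sigma_n^{1/n}$, which exists by submultiplicativity. Spectral bottom: $I$ denotes the identity matrix. The spectral bottom of $I-P$ is the largest $\lambda$ such that $\langle f,(I-P)f\rangle\ge\lambda\langle f,f\rangle$ for all $f\in\ell^2(V)$. *)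

(* Defs.v *)
From mathcomp Require Import all_boot all_order all_algebra finmap.
From mathcomp Require Import all_classical all_reals all_analysis.

Set Implicit Arguments.
Unset Strict Implicit.
Unset Printing Implicit Defensive.
Import Order.TTheory GRing.Theory Num.Theory.
Import numFieldNormedType.Exports.
Local Open Scope classical_set_scope.
Local Open Scope ring_scope.

Section Graph.
Variables (V : choiceType) (adj : rel V).

Definition nbrs (x : V) : set V := [set y | adj x y].

Definition locally_finite : Prop := forall x, finite_set (nbrs x).

(* Only meaningful when [nbrs x] is finite: [fset_set] sends infinite sets
   to the empty set. *)
Definition degree (x : V) : nat := #|` fset_set (nbrs x)|.

Definition connected_graph : Prop :=
  forall x y, exists p : seq V, path adj x p /\ last x p = y.

Definition graph_automorphism (phi : V -> V) : Prop :=
  bijective phi /\ (forall u v, adj (phi u) (phi v) = adj u v).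

Definition vertex_transitive : Prop :=
  forall x y, exists phi : V -> V, graph_automorphism phi /\ phi x = y.

(* A walk from [o] is given by the sequence of its vertices after [o]; as the
   graph is simple, this determines its edges. *)
Definition self_avoiding_walks (o : V) (n : nat) : set (seq V) :=
  [set p : seq V | [&& size p == n, path adj o p & uniq (o :: p)]].

Definition num_saw (o : V) (n : nat) : nat :=
  #|` fset_set (self_avoiding_walks o n)|.

Variable R : realType.

Definition connective_constant (o : V) : R :=
  limn (fun n : nat => (num_saw o n)%:R `^ (n%:R)^-1).

Definition srw_matrix (x y : V) : R :=
  if adj x y then (degree x)%:R^-1 else 0.

(* The rows of [srw_matrix] have finite support when the graph is locally
   finite, so this finitely supported sum is the usual matrix action. *)
Definition srw_op (f : V -> R) : V -> R :=
  fun x => \sum_(y \in [set: V]) srw_matrix x y * f y.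

End Graph.

Section SquareSummable.
Variables (V : choiceType) (R : realType).

Definition ell2 (f : V -> R) : Prop :=
  summable [set: V] (fun x => (f x ^+ 2)%:E).

(* [\esum] is only meant for nonnegative families, hence the splitting of the
   (absolutely convergent) sum of the [f x * g x] into its positive and
   negative parts. *)
Definition inner (f g : V -> R) : R :=
  let h := fun x => (f x * g x)%:E in
  fine (esum [set: V] h^\+ - esum [set: V] h^\-)%E.

Definition spectral_lower_bounds (T : (V -> R) -> V -> R) : set R :=
  [set l | forall f, ell2 f -> l * inner f f <= inner f (T f)].

Definition is_spectral_bottom (T : (V -> R) -> V -> R) (lam : R) : Prop :=
  spectral_lower_bounds T lam /\ ubound (spectral_lower_bounds T) lam.

End SquareSummable.

(* Main.v *)
Require Import Defs.
From mathcomp Require Import all_boot all_order all_algebra finmap.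
From mathcomp Require Import all_classical all_reals all_analysis.
From mathcomp Require Import zify ring lra.

Set Implicit Arguments.
Unset Strict Implicit.
Unset Printing Implicit Defensive.
Import Order.TTheory GRing.Theory Num.Theory.
Import numFieldNormedType.Exports.
Local Open Scope classical_set_scope.
Local Open Scope ring_scope.

(** The proof bounds from below the number of self-avoiding walks that never
    get trapped. Write b(A) for the number of edges leaving a finite vertex
    set A, and let the hull of a finite set X be X together with the finite
    components of its complement; it is finite, and only vertices of X touch
    its outside. Grow a walk v_0, v_1, ... and put H_k := hull (H_(k-1) + v_k).
    If v_(k+1) is any neighbour of v_k outside H_k, the walk can always be
    continued, and the number a_k >= 1 of such neighbours satisfies

       2 a_k >= Delta + b(H_k) - b(H_(k-1))             (edge_boundary_hull).

    To see this, let D be the set of vertices that H_k adds to H_(k-1). Among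
    its vertices only v_k touches the outside of H_k, so that b(D) is a_k plus
    the number e of edges between D and H_(k-1), while
    b(H_k) - b(H_(k-1)) = a_k - e = 2 a_k - b(D). The claim is thus equivalent
    to b(D) >= Delta, a case of Mader's theorem that the edge connectivity of a
    vertex-transitive graph is its degree (edge_boundary_ge_degree).

    Summing over k < n makes the total of the a_k at least
    (Delta n + b(H_(n-1))) / 2, up to a constant. The spectral bottom enters
    through the last term: testing the quadratic form of I - P on
    sum_k (Delta-1)^-k 1_(ball of radius k around A) gives

       b(A) >= lam Delta (Delta-1) / (Delta-2) |A|     (spectral_isoperimetry),

    and |H_(n-1)| >= n. Since a_k <= Delta - 1, Bernoulli's inequality gives
    a_k >= (Delta-1)^((a_k - 1)/(Delta-2)); multiplying the choices, the number
    of n-step walks is at least a constant times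
    (Delta-1)^(n (1 + c lam)/2)                    (nsaw_growth).

    Finally the counts are submultiplicative, so Fekete's lemma shows that
    their n-th roots do converge, and the bound passes to the limit
    (root_limit_ge). *)

(** * Counting, minimisation and a Bernoulli inequality *)

Lemma count_mem_sym (T : eqType) (s t : seq T) :
  uniq s -> uniq t -> count (mem s) t = count (mem t) s.
Proof.
move=> us ut; rewrite -!size_filter; apply/perm_size/uniq_perm.
- exact: filter_uniq.
- exact: filter_uniq.
by move=> x; rewrite !mem_filter andbC.
Qed.

Lemma count_sum (T : Type) (Q : pred T) (s : seq T) :
  count Q s = (\sum_(y <- s) Q y)%N.
Proof. by elim: s => [|y s IH]; rewrite ?big_nil // big_cons -IH. Qed.

Lemma exists_minimal (T : Type) (P : T -> Prop) (m : T -> nat) :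
  (exists x, P x) -> exists2 x, P x & forall y, P y -> (m x <= m y)%N.
Proof.
move=> [x Px].
have ex : exists n, `[< exists2 y, P y & m y = n >].
  by exists (m x); apply/asboolP; exists x.
case: (ex_minnP ex) => n /asboolP[y Py <-] mn.
by exists y => // z Pz; apply: mn; apply/asboolP; exists z.
Qed.

Lemma big_fset_diff (T : choiceType) (M : nmodType) (A B : {fset T})
    (F : T -> M) : {subset A <= B} ->
  \sum_(x <- B) F x = \sum_(x <- A) F x + \sum_(x <- (B `\` A)%fset) F x.
Proof.
move=> AB; rewrite (big_fsetID _ (mem A)) /=; congr (_ + _).
  apply: eq_fbigl => x; rewrite !inE /= andb_idl //; exact: AB.
by apply: eq_fbigl => x; rewrite !inE /= andbC.
Qed.

(** Convexity of the exponential between 0 and ln (1 + a). *)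
Lemma powR_bernoulli (R : realType) (a t : R) : 0 <= a -> 0 <= t <= 1 ->
  (1 + a) `^ t <= 1 + t * a.
Proof.
move=> a0 t01; have a1 : 0 < 1 + a by lra.
rewrite /powR gt_eqF //.
have [t_ge0 t_le1] := andP t01.
have := convex_expR (Itv01 t_ge0 t_le1) (ln (1 + a)) 0.
rewrite !convRE /= lnK ?posrE // expR0 mulr0 mulr1 addr0.
move=> /le_trans; apply.
rewrite /unstable.onem; lra.
Qed.

(** * Limits of submultiplicative sequences *)

(** Fekete's lemma; nonnegativity of u makes the infimum of the u n / n, which
    is the limit, finite. *)
Lemma fekete (R : realType) (u : nat -> R) :
    (forall n, 0 <= u n) -> (forall m n, u (m + n)%N <= u m + u n) ->
  cvgn (fun n => u n / n%:R).
Proof.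
move=> u0 sub; set E := [set u n.+1 / n.+1%:R | n in [set: nat]].
have infE : has_inf E.
  split; first by exists (u 1%N / 1), 0%N.
  by exists 0 => _ [n _ <-]; rewrite divr_ge0.
have lbE n : inf E <= u n.+1 / n.+1%:R.
  by apply: ge_inf; [exact: infE.2|exists n].
apply/cvg_ex; exists (inf E); apply/cvgrPdist_le => e e0 /=.
have [_ [m _ <-] um] := inf_adherent (divr_gt0 e0 (ltr0n _ 2)) infE.
set M := \sum_(s < m.+1) u s.
have M0 : 0 <= M by exact: sumr_ge0.
have multiple q : u (q * m.+1)%N <= q%:R * u m.+1 + u 0%N.
  elim: q => [|q IH]; first by rewrite mul0r add0r.
  rewrite mulSn -[q.+1]add1n natrD mulrDl mul1r -addrA.
  by apply: le_trans (sub _ _) _; rewrite lerD2l.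
(* Euclidean division of n by the near-optimal index m.+1; M bounds u at the
   remainder, whatever it is. *)
have bound n : u n <= n%:R * (inf E + e / 2) + (u 0%N + M).
  rewrite {1}(divn_eq n m.+1).
  have rest : u (n %% m.+1)%N <= M.
    rewrite /M (bigD1 (Ordinal (ltn_pmod n (ltn0Sn m)))) //= lerDl.
    exact: sumr_ge0.
  apply: le_trans (sub _ _) _; rewrite addrA; apply: lerD => //.
  apply: le_trans (multiple _) _; rewrite lerD2r.
  rewrite ltr_pdivrMr // in um.
  apply: le_trans (ler_wpM2l (ler0n _ _) (ltW um)) _.
  rewrite mulrCA mulrC -natrM; apply: ler_wpM2r; last first.
    by rewrite ler_nat leq_trunc_div.
  apply: addr_ge0; last by rewrite divr_ge0 // ltW.
  by apply: lb_le_inf infE.1 _ => _ [k _ <-]; rewrite divr_ge0.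
near=> n.
have n0 : (0 < n)%N by near: n; exact: nbhs_infty_gt.
have nM : (u 0%N + M) / (e / 2) <= n%:R by near: n; exact: nbhs_infty_ger.
have n0R : 0 < n%:R :> R by rewrite ltr0n.
have lb : inf E <= u n / n%:R by move: (lbE n.-1); rewrite prednK.
rewrite distrC ger0_norm ?subr_ge0 // lerBlDl ler_pdivrMr //.
apply: le_trans (bound n) _.
rewrite ler_pdivrMr ?divr_gt0 // in nM.
lra.
Unshelve. all: by end_near.
Qed.

(** Convergence has to be established first, as a lower bound on the terms says
    nothing about the default value that lim takes on divergent sequences. *)
Lemma root_limit_ge (R : realType) (s : nat -> nat) (D B C : R) :
    1 < D -> (forall n, 0 < s n)%N ->
    (forall m n, s (m + n)%N <= s m * s n)%N ->
    (forall n, D `^ (B * n%:R - C) <= (s n)%:R) ->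
  D `^ B <= limn (fun n => (s n)%:R `^ (n%:R)^-1).
Proof.
move=> D1 s0 sub lower; have D0 : 0 < D by lra.
have sR n : 0 < (s n)%:R :> R by rewrite ltr0n.
pose u n : R := ln (s n)%:R.
have ucv : cvgn (fun n => u n / n%:R).
  apply: fekete => [n|m n]; first by rewrite ln_ge0 // ler1n.
  by rewrite /u -lnM ?posrE // ler_ln ?posrE ?mulr_gt0 // -natrM ler_nat.
set L := limn (fun n => u n / n%:R) in ucv.
have BL : B * ln D <= L.
  have low : B * ln D - C * ln D * n%:R^-1 @[n --> \oo] --> B * ln D.
    rewrite -[X in _ --> X]subr0; apply: cvgB; first exact: cvg_cst.
    rewrite -(mulr0 (C * ln D)); apply: cvgMr.
    by apply/gtr0_cvgV0; [near=> n; rewrite ltr0n; near: n; exact: nbhs_infty_gt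
      |exact: cvgr_idn].
  rewrite -(cvg_lim _ low) //; apply: ler_lim => //.
    by apply/cvg_ex; exists (B * ln D).
  near=> n; have n0 : (0 < n)%N by near: n; exact: nbhs_infty_gt.
  have n0R : 0 < n%:R :> R by rewrite ltr0n.
  rewrite ler_pdivlMr // mulrBl mulfVK ?gt_eqF //.
  have := lower n; rewrite -ler_ln ?posrE ?powR_gt0 // ln_powR.
  by rewrite /u; lra.
have -> : limn (fun n => (s n)%:R `^ n%:R^-1) = expR L.
  apply: cvg_lim => //.
  rewrite (_ : (fun n => _) = (fun n => expR (u n / n%:R))); last first.
    by apply/funext => n; rewrite /powR gt_eqF // mulrC.
  by apply: continuous_cvg ucv; exact: continuous_expR.
by rewrite /powR gt_eqF // ler_expR.
Unshelve. all: by end_near.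
Qed.

(** * Sums of finitely supported functions *)

Section FiniteSupport.
Variables (V : choiceType) (R : realType).
Implicit Types (f g : V -> R) (U : {fset V}).

Lemma esum_finite_support U (h : V -> \bar R) :
    (forall x, 0 <= h x)%E -> (forall x, x \notin U -> h x = 0%E) ->
  esum [set: V] h = (\sum_(x <- U) h x)%E.
Proof.
move=> h0 hU.
transitivity (esum [set` U] h).
  rewrite [RHS]esum_mkcond; apply: eq_esum => x _.
  case: ifPn => // /negP xU; apply: hU; apply/negP => xU'.
  by apply: xU; exact/mem_set.
have finU := finite_fset U.
by rewrite esum_fset // fsbig_finite // set_fsetK.
Qed.

Lemma inner_finite_support U f g : (forall x, x \notin U -> f x = 0) ->
  inner f g = \sum_(x <- U) f x * g x.
Proof.
move=> fU; rewrite /inner; set h := fun x => (f x * g x)%:E.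
have hU x : x \notin U -> h x = 0%E.
  by move=> /fU; rewrite /h => ->; rewrite mul0r.
rewrite !(@esum_finite_support U).
- under eq_bigr do rewrite funeposE /h -EFin_max.
  under [X in (_ - X)%E]eq_bigr do rewrite funenegE /h -EFinN -EFin_max.
  rewrite !sumEFin -EFinB /= -sumrB; apply: eq_bigr => x _.
  by have [] := leP (f x * g x) 0; have [] := leP (- (f x * g x)) 0; lra.
- by move=> x; exact: funeneg_ge0.
- by move=> x /hU; rewrite funenegE => ->; rewrite oppe0 maxxx.
- by move=> x; exact: funepos_ge0.
- by move=> x /hU; rewrite funeposE => ->; rewrite maxxx.
Qed.

Lemma ell2_finite_support U f : (forall x, x \notin U -> f x = 0) -> ell2 f.
Proof.
move=> fU; rewrite /ell2 /summable (@esum_finite_support U) //.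
  under eq_bigr do rewrite abse_EFin.
  by rewrite sumEFin ltry.
by move=> x /fU ->; rewrite expr0n abse_EFin normr0.
Qed.
End FiniteSupport.

(** * Edges leaving a finite set *)

Section Graph.
Local Open Scope fset_scope.
Local Open Scope nat_scope.
Variables (V : choiceType) (adj : rel V).
Hypothesis adj_sym : symmetric adj.
Hypothesis locfin : locally_finite adj.

Definition neighbours (x : V) : {fset V} := fset_set (nbrs adj x).

Lemma in_neighbours x y : (y \in neighbours x) = adj x y.
Proof.
by rewrite in_fset_set //; apply/idP/idP => [/set_mem|xy]; last exact/mem_set.
Qed.

Definition edges_to (A : {fset V}) (Q : pred V) : nat :=
  \sum_(x <- A) count Q (neighbours x).

Definition edge_boundary (A : {fset V}) : nat :=
  edges_to A (fun y => y \notin A).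

Lemma edges_to_widen (A U : {fset V}) Q : A `<=` U ->
  edges_to A Q = \sum_(x <- U) (x \in A) * count Q (neighbours x).
Proof.
move=> AU; rewrite -(big_fset_incl _ AU); last first.
  by move=> x _ /negbTE ->.
by apply: eq_big_seq => x ->; rewrite mul1n.
Qed.

Lemma edges_toU (A B : {fset V}) Q : [disjoint A & B] ->
  edges_to (A `|` B) Q = edges_to A Q + edges_to B Q.
Proof.
move=> /fdisjointP AB.
rewrite !(@edges_to_widen _ (A `|` B)) ?fsubsetUl ?fsubsetUr // -big_split /=.
apply: eq_bigr => x _; rewrite in_fsetU.
by have := AB x; case: (x \in A) => [/(_ isT)/negbTE ->|_]; rewrite -?mulnDl.
Qed.

(** The exclusive or, together with the disjointness of Q1 and Q2, says that
    they partition Q among the neighbours of A. *)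
Lemma edges_to_split (A : {fset V}) (Q Q1 Q2 : pred V) :
    (forall x y, x \in A -> adj x y -> Q y = Q1 y (+) Q2 y) ->
    (forall y, Q1 y -> ~~ Q2 y) ->
  edges_to A Q = edges_to A Q1 + edges_to A Q2.
Proof.
move=> QE dis; rewrite -big_split /=; apply: eq_big_seq => x xA.
have -> : count Q (neighbours x) = count (predU Q1 Q2) (neighbours x).
  apply: eq_in_count => y; rewrite in_neighbours => xy /=.
  by rewrite (QE x) //; have := dis y; case: (Q1 y); case: (Q2 y) => // /(_ isT).
rewrite -count_predUI -[LHS]addn0; congr (_ + _).
by rewrite (@eq_count _ _ pred0) ?count_pred0 // => y /=; have := dis y;
  case: (Q1 y); case: (Q2 y) => // /(_ isT).
Qed.

Lemma eq_edges_to (A : {fset V}) (Q1 Q2 : pred V) :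
    (forall x y, x \in A -> adj x y -> Q1 y = Q2 y) ->
  edges_to A Q1 = edges_to A Q2.
Proof.
move=> QE; apply: eq_big_seq => x xA; apply: eq_in_count => y.
by rewrite in_neighbours; apply: QE.
Qed.

Lemma edges_to_sym (A B : {fset V}) :
  edges_to A (mem B) = edges_to B (mem A).
Proof.
have E (A' B' : {fset V}) :
    edges_to A' (mem B') = \sum_(x <- A') \sum_(y <- B') adj x y.
  apply: eq_bigr => x _; rewrite count_mem_sym ?fset_uniq // count_sum.
  by apply: eq_bigr => y _; rewrite /= in_neighbours.
rewrite !E exchange_big /=; apply: eq_bigr => x _; apply: eq_bigr => y _.
by rewrite adj_sym.
Qed.

(** The inequality already holds for each pair (x, y) of adjacent vertices:
    a pair that leaves the intersection or the union, or both, leaves at least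
    as many of A and B. *)
Lemma edge_boundary_submodular (A B : {fset V}) :
  edge_boundary (A `&` B) + edge_boundary (A `|` B) <=
  edge_boundary A + edge_boundary B.
Proof.
rewrite /edge_boundary !(@edges_to_widen _ (A `|` B)) ?fsubsetUl ?fsubsetUr //;
  last by apply: (fsubset_trans (fsubsetIl _ _)); exact: fsubsetUl.
rewrite -!big_split /=; apply: leq_sum => x _.
rewrite !count_sum !big_distrr /= -!big_split /=.
apply: leq_sum => y _; rewrite !inE.
by case: (x \in A); case: (x \in B); case: (y \in A); case: (y \in B).
Qed.

Section Regular.
Variable Delta : nat.
Hypothesis deg : forall x, degree adj x = Delta.

Lemma size_neighbours x : size (neighbours x) = Delta.
Proof. exact: deg. Qed.

Hypothesis adj_irr : irreflexive adj.
Hypothesis V_inf : infinite_set [set: V].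
Hypothesis conn : connected_graph adj.
Hypothesis trans : vertex_transitive adj.

(** * Edge connectivity of a vertex-transitive graph *)

Lemma edge_boundary_gt0 (A : {fset V}) : A != fset0 -> 0 < edge_boundary A.
Proof.
case/fset0Pn => x xA.
have [y yA] : exists y, y \notin A.
  apply: contrapT => H; apply: V_inf; apply: (sub_finite_set _ (finite_fset A)).
  by move=> y _ /=; apply/negP => /negP yA; apply: H; exists y.
have [p [xp py]] := conn x y.
have [u [v [uA uv vA]]] : exists u v, [/\ u \in A, adj u v & v \notin A].
  elim: p x xA xp py => [|z p IH] x xA /=.
    by move=> _ xy; move: yA; rewrite -xy xA.
  case/andP => xz zp py; have [zA|zA] := boolP (z \in A); first exact: IH zp py.
  by exists x, z.
rewrite /edge_boundary /edges_to (big_fsetD1 u) //= ltn_addr // -has_count.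
by apply/hasP; exists v; rewrite ?in_neighbours.
Qed.

Lemma in_automorphism_image (phi : V -> V) (A : {fset V}) x : injective phi ->
  (phi x \in (phi @` A)) = (x \in A).
Proof.
by move=> inj; apply/imfsetP/idP => [[z zA /inj ->]|xA] //; exists x.
Qed.

Lemma automorphism_neighbours phi x : graph_automorphism adj phi ->
  perm_eq (neighbours (phi x)) (map phi (neighbours x)).
Proof.
move=> [bij hom]; apply: uniq_perm; rewrite ?fset_uniq //.
  by rewrite map_inj_uniq ?fset_uniq //; exact: bij_inj.
move=> y; rewrite in_neighbours; apply/idP/mapP => [xy|[z]].
  have [psi _ K] := bij; exists (psi y); last by rewrite K.
  by rewrite in_neighbours -hom K.
by rewrite in_neighbours => xz ->; rewrite hom.
Qed.

Lemma count_automorphism phi (A : {fset V}) x : graph_automorphism adj phi ->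
  count (fun y => y \notin (phi @` A)) (neighbours (phi x)) =
  count (fun y => y \notin A) (neighbours x).
Proof.
move=> aut; rewrite (permP (automorphism_neighbours x aut)) count_map.
by apply: eq_count => y /=; rewrite in_automorphism_image //; exact: bij_inj aut.1.
Qed.

Lemma edge_boundary_automorphism phi (A : {fset V}) :
  graph_automorphism adj phi ->
  edge_boundary (phi @` A) = edge_boundary A.
Proof.
move=> aut; rewrite /edge_boundary /edges_to big_imfset /=; last first.
  by move=> ? ? _ _ /(bij_inj aut.1).
by apply: eq_bigr => x _; exact: count_automorphism.
Qed.

(** Mader's theorem. Let B minimise the boundary among nonempty finite sets,
    and the cardinality among those. If an automorphic image of B meets B
    without being equal to it, submodularity makes their intersection a smaller
    minimiser; so B is a block of imprimitivity, and all its vertices have the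
    same number t >= 1 of neighbours outside B. As at most |B| - 1 neighbours
    of a vertex of B lie in B, t >= Delta - |B| + 1, and the boundary |B| t is
    at least Delta both when |B| >= Delta and when |B| < Delta. *)
Lemma edge_boundary_ge_degree (A : {fset V}) :
  A != fset0 -> Delta <= edge_boundary A.
Proof.
move=> A0.
have [A1 A10 min1] := @exists_minimal _ (fun B : {fset V} => B != fset0)
  edge_boundary (ex_intro _ A A0).
have [B [B0 Bmin] min2] := @exists_minimal _ (fun B : {fset V} =>
  B != fset0 /\ forall C, C != fset0 -> edge_boundary B <= edge_boundary C)
  (fun B => #|` B|) (ex_intro _ A1 (conj A10 min1)).
apply: leq_trans (Bmin _ A0).
have block phi x : graph_automorphism adj phi -> x \in B -> phi x \in B ->
    (phi @` B) = B.
  move=> aut xB pxB; set C := (_ @` _).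
  have cardC : #|` C| = #|` B| by rewrite card_imfset //; exact: bij_inj aut.1.
  have pxC : phi x \in C by rewrite in_automorphism_image //; exact: bij_inj aut.1.
  apply/eqP; apply: contrapT => /negP CB.
  have I0 : C `&` B != fset0 by apply/fset0Pn; exists (phi x); rewrite inE pxC.
  have U0 : C `|` B != fset0 by apply/fset0Pn; exists (phi x); rewrite inE pxC.
  have := edge_boundary_submodular C B.
  rewrite edge_boundary_automorphism // => sub.
  have bI : edge_boundary (C `&` B) <= edge_boundary B.
    by have := Bmin _ U0; lia.
  have : #|` B| <= #|` C `&` B|.
    by apply: min2; split => // D D0; apply: leq_trans bI (Bmin _ D0).
  apply/negP; rewrite -ltnNge; apply: fproper_ltn_card.
  rewrite fproperE fsubsetIr /=; apply: contra CB => BI.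
  by rewrite eq_sym eqEfcard cardC leqnn andbT (fsubset_trans BI) ?fsubsetIl.
have [x0 x0B] := fset0Pn _ B0.
pose t := count (fun y => y \notin B) (neighbours x0).
have tE x : x \in B -> count (fun y => y \notin B) (neighbours x) = t.
  move=> xB; have [phi [aut px]] := trans x0 x.
  have <- : phi @` B = B by apply: (block _ x0); rewrite ?px.
  by rewrite -px count_automorphism.
have bE : edge_boundary B = #|` B| * t.
  rewrite /edge_boundary /edges_to (eq_big_seq (fun=> t)) //.
  by rewrite big_const_seq count_predT iter_addn_0 mulnC.
have t0 : 0 < t by have := edge_boundary_gt0 B0; rewrite bE muln_gt0 => /andP[].
have tD : Delta <= t + #|` B|.-1.
  rewrite -(size_neighbours x0) -(count_predC (mem B)) addnC leq_add2l.
  rewrite (cardfsD1 x0) x0B /= count_mem_sym ?fset_uniq // -size_filter.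
  apply: uniq_leq_size; first by rewrite filter_uniq ?fset_uniq.
  move=> y; rewrite mem_filter /= in_neighbours !inE => /andP[xy ->].
  by rewrite andbT; apply: contraTneq xy => ->; rewrite adj_irr.
have B1 : 0 < #|` B| by rewrite cardfs_gt0.
rewrite bE; have [?|?] := leqP Delta #|` B|; nia.
Qed.

(** * Isoperimetry from the spectral bottom *)

Section SpectralIsoperimetry.
Local Open Scope ring_scope.
Variables (R : realType).
Implicit Types (f g : V -> R) (A B U : {fset V}).

Definition laplacian f (x : V) : R := \sum_(y <- neighbours x) (f x - f y).

Lemma srw_op_neighbours f x : srw_op adj f x =
  Delta%:R^-1 * \sum_(y <- neighbours x) f y.
Proof.
rewrite /srw_op big_distrr /=.
rewrite -(@fsbig_widen _ _ 0 _ [set` neighbours x] [set: V]) //=; last first.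
  move=> y /= [_ /negP]; rewrite in_neighbours /srw_matrix => /negbTE ->.
  by rewrite mul0r.
rewrite fsbig_finite; last exact: finite_fset.
rewrite set_fsetK; apply: eq_big_seq => y.
by rewrite in_neighbours /srw_matrix => ->; rewrite deg.
Qed.

Lemma srw_laplacian f x : (0 < Delta)%N ->
  (f \- srw_op adj f) x = Delta%:R^-1 * laplacian f x.
Proof.
move=> D0; rewrite /= srw_op_neighbours /laplacian sumrB mulrBr; congr (_ - _).
rewrite big_const_seq count_predT iter_addr_0 size_neighbours -[f x *+ _]mulr_natl.
by rewrite mulKf // pnatr_eq0 -lt0n.
Qed.

Definition indicator B (x : V) : R := (x \in B)%:R.

Lemma laplacian_indicator B x : laplacian (indicator B) x =
  if x \in B then (count (fun y => y \notin B) (neighbours x))%:R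
  else - (count (mem B) (neighbours x))%:R.
Proof.
rewrite /laplacian !count_sum !natr_sum /indicator.
case: ifP => xB; rewrite -?sumrN; apply: eq_bigr => y _ /=.
  by case: (y \in B); rewrite ?subrr ?subr0.
by rewrite sub0r.
Qed.

(** No edge leaves both sets, which makes the indicators of B and B' orthogonal
    for the Dirichlet form. *)
Definition is_thickening B B' :=
  {subset B <= B'} /\ forall x y, x \in B -> adj x y -> y \in B'.

Lemma sum_laplacian_self B :
  \sum_(x <- B) laplacian (indicator B) x = (edge_boundary B)%:R.
Proof.
rewrite natr_sum; apply: eq_big_seq => x xB.
by rewrite laplacian_indicator xB.
Qed.

Lemma sum_laplacian_inside B B' : is_thickening B B' ->
  \sum_(x <- B) laplacian (indicator B') x = 0.
Proof.
move=> [BB' nB]; rewrite big_seq big1 // => x xB.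
rewrite laplacian_indicator BB' //; apply/eqP; rewrite pnatr_eq0 -leqn0 leqNgt.
rewrite -has_count; apply/hasPn => y; rewrite in_neighbours => xy.
by rewrite negbK; exact: nB xy.
Qed.

(** Every edge leaving B stays in B', and it contributes 1 at its end in B and
    -1 at its end in B'. *)
Lemma sum_laplacian_outside B B' : is_thickening B B' ->
  \sum_(x <- B') laplacian (indicator B) x = 0.
Proof.
move=> [BB' nB].
rewrite (big_fset_diff _ BB') sum_laplacian_self.
rewrite (eq_big_seq (fun x => - (count (mem B) (neighbours x))%:R)); last first.
  by move=> x; rewrite in_fsetD laplacian_indicator => /andP[/negbTE ->].
rewrite sumrN -natr_sum -/(edges_to (B' `\` B) (mem B)) edges_to_sym.
apply/eqP; rewrite subr_eq0 eqr_nat; apply/eqP/eq_edges_to => x y xB xy.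
by rewrite /= in_fsetD (nB x) // andbT.
Qed.

(** The mixed terms vanish by orthogonality of the indicators of nested
    thickenings, leaving the energies of the single layers. *)
Lemma dirichlet_form_layers (K : nat) (c : nat -> R) (B : nat -> {fset V}) U :
    (forall j k, (j < k)%N -> is_thickening (B j) (B k)) ->
    (forall k, (k < K)%N -> B k `<=` U) ->
  let f x := \sum_(k < K) c k * indicator (B k) x in
  \sum_(x <- U) f x * laplacian f x =
    \sum_(k < K) c k ^+ 2 * (edge_boundary (B k))%:R.
Proof.
move=> thick BU f.
have lapf x : laplacian f x = \sum_(k < K) c k * laplacian (indicator (B k)) x.
  rewrite /laplacian; under eq_bigr do rewrite -sumrB.
  rewrite exchange_big /=; apply: eq_bigr => k _.
  by rewrite big_distrr /=; apply: eq_bigr => y _; rewrite mulrBr.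
transitivity (\sum_(j < K) \sum_(k < K)
    c j * c k * \sum_(x <- B j) laplacian (indicator (B k)) x).
  under eq_bigr do rewrite lapf big_distrlr /=.
  rewrite exchange_big /=; apply: eq_bigr => j _.
  rewrite exchange_big /=; apply: eq_bigr => k _.
  rewrite -(big_fset_incl _ (BU j (ltn_ord j))); last first.
  by move=> x _ xB; rewrite /indicator (negbTE xB) mulr0 mul0r.
  rewrite big_distrr /=; apply: eq_big_seq => x xB.
  by rewrite /indicator xB mulr1 mulrA.
apply: eq_bigr => k _; rewrite (bigD1 k) //= sum_laplacian_self -expr2.
rewrite big1 ?addr0 // => j; rewrite -val_eqE /= neq_ltn => /orP[] lt.
  by rewrite sum_laplacian_outside ?mulr0 //; exact: thick.
by rewrite sum_laplacian_inside ?mulr0 //; exact: thick.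
Qed.


Definition thicken B : {fset V} := B `|` \bigcup_(x <- B) neighbours x.

Lemma thickenP B : is_thickening B (thicken B).
Proof.
split=> [x xB|x y xB xy]; rewrite in_fsetU ?xB //; apply/orP; right.
by apply/bigfcupP; exists x; rewrite ?xB ?in_neighbours.
Qed.

Lemma thicken_new B x : x \in thicken B -> x \notin B ->
  exists2 y, y \in B & adj x y.
Proof.
rewrite in_fsetU => /orP[->//|/bigfcupP[y /andP[yB _]]].
by rewrite in_neighbours adj_sym; exists y.
Qed.

(** Edges leaving the thickening start at its new vertices. Each of these
    spends at least one of its Delta edges on B, and these edges to B are edges
    leaving B. *)
Lemma edge_boundary_thicken B :
  (edge_boundary (thicken B) <= Delta.-1 * edge_boundary B)%N.
Proof.
have [BB' nB] := thickenP B; set B' := thicken B in BB' nB *.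
have BE : B' = B `|` B' `\` B.
  by apply/fsetP => x; rewrite !inE; have := BB' x; case: (x \in B) => //= ->.
rewrite /edge_boundary {1}BE edges_toU; last first.
  by apply/fdisjointP => x xB; rewrite in_fsetD xB.
rewrite [X in (X + _)%N](_ : _ = 0)%N ?add0n; last first.
  rewrite /edges_to big_seq big1 // => x xB; apply/eqP.
  rewrite -leqn0 leqNgt -has_count; apply/hasPn => y; rewrite in_neighbours => xy.
  by rewrite negbK (nB x).
apply: (@leq_trans (Delta.-1 * edges_to B (mem (B' `\` B)))); last first.
  rewrite leq_mul2l; apply/orP; right; apply: leq_sum => x _.
  by apply: sub_count => y; rewrite /= in_fsetD => /andP[].
rewrite edges_to_sym big_distrr /= /edges_to big_seq [leqRHS]big_seq.
apply: leq_sum => x; rewrite in_fsetD => /andP[xB xB'].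
have [y yB xy] := thicken_new xB' xB.
have c1 : (0 < count (mem B) (neighbours x))%N.
  by rewrite -has_count; apply/hasP; exists y; rewrite ?in_neighbours.
have : (count (mem B) (neighbours x) +
    count (fun y => y \notin B') (neighbours x) <= Delta)%N.
  rewrite -(size_neighbours x) -(count_predC (mem B)) leq_add2l.
  by apply: sub_count => z; apply: contra => /=; exact: BB'.
by nia.
Qed.

Definition thickening A k : {fset V} := iter k thicken A.

Lemma thickening_subset A j k : (j <= k)%N ->
  {subset thickening A j <= thickening A k}.
Proof.
move=> /subnK <-; elim: (k - j)%N => [//|i IH] x /IH xi.
by rewrite addSn /=; have [sub _] := thickenP (thickening A (i + j)); exact: sub.
Qed.

Lemma thickening_lt A j k : (j < k)%N ->
  is_thickening (thickening A j) (thickening A k).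
Proof.
move=> jk; have [sub nb] := thickenP (thickening A j).
have sub' := @thickening_subset A _ _ jk; split=> [x|x y xj xy].
  by move=> /sub; exact: sub'.
by apply: sub'; exact: nb xj xy.
Qed.

Lemma edge_boundary_thickening A k :
  (edge_boundary (thickening A k) <= Delta.-1 ^ k * edge_boundary A)%N.
Proof.
elim: k => [|k IH]; first by rewrite mul1n.
apply: leq_trans (edge_boundary_thicken _) _.
by rewrite expnS -mulnA leq_mul2l IH orbT.
Qed.

(** The test function is f = sum_(k < K) (Delta-1)^-k 1_(A_k), where A_k is the
    k-th thickening of A. With s the sum of the coefficients, f = s on A, so
    <f, f> >= s^2 |A|; and as A_k has at most (Delta-1)^k b(A) leaving edges,
    Delta <f, (I - P) f> <= sum_k (Delta-1)^-2k (Delta-1)^k b(A) = s b(A).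
    On a regular tree, for connected A, the function f approximates a multiple
    of the one that is 1 on A, harmonic off A and tends to 0, which minimises
    the energy; hence the choice of coefficients. The truncation at K keeps the
    support finite. *)
Lemma spectral_isoperimetry_truncated (lam : R) A K :
    spectral_lower_bounds (fun f => f \- srw_op adj f) lam ->
    (1 < Delta)%N -> 0 <= lam -> (0 < K)%N ->
  lam * #|` A|%:R * (\sum_(k < K) (Delta%:R - 1) ^- k) <=
    (edge_boundary A)%:R / Delta%:R.
Proof.
move=> lamP D1 lam0 K0; set s := \sum_(k < K) _.
have D1R : 2 <= Delta%:R :> R by rewrite (ler_nat _ 2).
have a1 : 1 <= Delta%:R - 1 :> R by lra.
pose c k : R := (Delta%:R - 1) ^- k.
have c_gt0 k : 0 < c k by rewrite invr_gt0 exprn_gt0 //; lra.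
have s_gt0 : 0 < s.
  rewrite /s; case: K K0 {s} => // K _; rewrite big_ord_recl ltr_pwDl //.
  - exact: (c_gt0 0).
  - by apply: sumr_ge0 => k _; exact: ltW (c_gt0 _).
pose f x := \sum_(k < K) c k * indicator (thickening A k) x.
set U := thickening A K.
have fU x : x \notin U -> f x = 0.
  move=> xU; apply: big1 => k _; rewrite /indicator (_ : _ \in _ = false) ?mulr0 //.
  by apply: contraNF xU; apply: thickening_subset; exact: ltnW.
have fA x : x \in A -> f x = s.
  move=> xA; apply: eq_bigr => k _.
  by rewrite /indicator (@thickening_subset A 0) // mulr1.
have AU : A `<=` U by apply/fsubsetP; exact: (@thickening_subset A 0).
have := lamP f (ell2_finite_support fU).
rewrite !(inner_finite_support _ fU).
under [X in _ <= X -> _]eq_bigr do rewrite (srw_laplacian _ _ (ltnW D1)) mulrCA.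
rewrite -big_distrr /= dirichlet_form_layers; first last.
- by move=> k kK; apply/fsubsetP/thickening_subset/ltnW.
- by move=> j k; exact: thickening_lt.
move=> main.
have lower : #|` A|%:R * s ^+ 2 <= \sum_(x <- U) f x * f x.
  rewrite (big_fset_diff _ (fsubsetP AU)) /= ler_wpDr //.
    by apply: sumr_ge0 => x _; rewrite -expr2 sqr_ge0.
  rewrite (eq_big_seq (fun=> s ^+ 2)); last by move=> x /fA ->; rewrite expr2.
  by rewrite big_const_seq count_predT iter_addr_0 mulr_natl.
have upper : \sum_(k < K) c k ^+ 2 * (edge_boundary (thickening A k))%:R
    <= s * (edge_boundary A)%:R.
  rewrite /s big_distrl /=; apply: ler_sum => k _.
  rewrite expr2 -mulrA ler_wpM2l //; first exact: ltW (c_gt0 k).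
  rewrite /c ler_pdivrMl ?exprn_gt0 //; last by lra.
  have := edge_boundary_thickening A k; rewrite -(ler_nat R) natrM natrX.
  by rewrite -subn1 natrB ?(ltnW D1) // mulrC.
have : lam * (#|` A|%:R * s ^+ 2) <= Delta%:R^-1 * (s * (edge_boundary A)%:R).
  apply: le_trans (ler_wpM2l lam0 lower) _; apply: le_trans main _.
  by rewrite ler_wpM2l // invr_ge0.
rewrite (_ : lam * _ = (lam * #|` A|%:R * s) * s); last by ring.
rewrite (_ : Delta%:R^-1 * _ = ((edge_boundary A)%:R / Delta%:R) * s); last by ring.
by rewrite ler_pM2r.
Qed.

(** Let K tend to infinity: the geometric sum tends to
    (Delta-1) / (Delta-2). *)
Lemma spectral_isoperimetry (lam : R) A :
    spectral_lower_bounds (fun f => f \- srw_op adj f) lam ->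
    (3 <= Delta)%N -> 0 <= lam ->
  lam * (Delta%:R * (Delta%:R - 1) / (Delta%:R - 2)) * #|` A|%:R
    <= (edge_boundary A)%:R.
Proof.
move=> lamP D3 lam0; have D3R : 3 <= Delta%:R :> R by rewrite (ler_nat _ 3).
set r : R := (Delta%:R - 1)^-1.
have r0 : 0 < r by rewrite invr_gt0; lra.
have r1 : r < 1 by rewrite invf_lt1; lra.
have bound K : (0 < K)%N -> lam * #|` A|%:R * (1 - r ^+ K) <=
    (edge_boundary A)%:R / Delta%:R * (1 - r).
  move=> K0.
  have := spectral_isoperimetry_truncated A lamP (ltnW D3) lam0 K0.
  under eq_bigr do rewrite -exprVn -/r.
  have geo : 1 - r ^+ K = (\sum_(k < K) r ^+ k) * (1 - r).
    by rewrite -[in LHS]opprB subrX1 mulrC -mulrN opprB.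
  by rewrite geo mulrA => le; apply: ler_wpM2r le; lra.
have lim : lam * #|` A|%:R * (1 - r ^+ K) @[K --> \oo] --> lam * #|` A|%:R.
  rewrite -[X in _ --> X]mulr1 -{4}(subr0 1); apply: cvgMr.
  apply: cvgB; first exact: cvg_cst.
  by apply: cvg_expr; rewrite gtr0_norm.
have : lam * #|` A|%:R <= (edge_boundary A)%:R / Delta%:R * (1 - r).
  rewrite -(cvg_lim _ lim) //.
  apply: limr_le; first by apply/cvg_ex; exists (lam * #|` A|%:R).
  by near=> K; apply: bound; near: K; exact: nbhs_infty_gt.
rewrite (_ : (edge_boundary A)%:R / Delta%:R * (1 - r) = (edge_boundary A)%:R /
    (Delta%:R * (Delta%:R - 1) / (Delta%:R - 2))); last first.
  by rewrite /r; field; rewrite !gt_eqF //; lra.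
rewrite ler_pdivlMr; first by rewrite mulrAC.
by rewrite divr_gt0 ?mulr_gt0 //; lra.
Unshelve. all: by end_near.
Qed.

End SpectralIsoperimetry.
(** * Hulls and the number of ways out *)

(** Connection in the complement of X; both ends lie outside X. *)
Inductive reach (X : {fset V}) (x : V) : V -> Prop :=
| reach_start : x \notin X -> reach X x x
| reach_step y z : reach X x y -> adj y z -> z \notin X -> reach X x z.

(** For finite X this means that x can be continued to an infinite
    self-avoiding walk off X, the graph being locally finite; stating it by the
    size of the component avoids infinite walks altogether. *)
Definition escapes (X : {fset V}) (x : V) : Prop :=
  infinite_set [set y | reach X x y].

Definition hull (X : {fset V}) : {fset V} :=
  fset_set [set x | ~ escapes X x]%classic.

Lemma reach_notinl X x y : reach X x y -> x \notin X.
Proof. by elim. Qed.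

Lemma reach_notinr X x y : reach X x y -> y \notin X.
Proof. by elim. Qed.

Lemma reach_trans X x y z : reach X x y -> reach X y z -> reach X x z.
Proof. by move=> xy; elim=> // u w _ xu; exact: reach_step. Qed.

Lemma reach_sym X x y : reach X x y -> reach X y x.
Proof.
elim=> [xX|u w xu ux uw wX]; first exact: reach_start.
apply: reach_trans ux; apply: reach_step (reach_start wX) _ (reach_notinr xu).
by rewrite adj_sym.
Qed.

Lemma reach_sub (X Y : {fset V}) x y :
  {subset X <= Y} -> reach Y x y -> reach X x y.
Proof.
move=> XY; have nXY z : z \notin Y -> z \notin X by apply: contra; exact: XY.
elim=> [/nXY|u w _ xu uw /nXY]; [exact: reach_start|exact: reach_step xu uw].
Qed.

Lemma escapes_reach X x y : reach X x y -> escapes X y -> escapes X x.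
Proof.
move=> xy esc fin; apply: esc; apply: sub_finite_set fin => z.
exact: reach_trans.
Qed.

Lemma escapes_notin X x : escapes X x -> x \notin X.
Proof.
move=> esc; apply/negP => xX; apply: esc.
rewrite (_ : [set _ | _]%classic = set0) //; apply/seteqP; split => // y /=.
by move/reach_notinl; rewrite xX.
Qed.

(** The graph is connected, so each component of the complement of X contains
    one of the finitely many neighbours of X. *)
Lemma hull_finite X : X != fset0 -> finite_set [set x | ~ escapes X x]%classic.
Proof.
case/fset0Pn => o oX.
pose B : {fset V} := \bigcup_(x <- X) neighbours x.
apply: (@sub_finite_set _ _ ([set` X] `|` \bigcup_(w in
  [set w | w \in B /\ ~ escapes X w]) [set y | reach X w y])%classic); last first.
  rewrite finite_setU; split; first exact: finite_fset.
  apply: bigcup_finite => [|w [_ /contrapT//]].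
  by apply: sub_finite_set (finite_fset B) => w [].
move=> x /= nesc; have [xX|xX] := boolP (x \in X); [by left|right].
have [p [xp po]] := conn x o.
have [u [w [xu wX uw]]] : exists u w, [/\ reach X x u, w \in X & adj u w].
  elim: p x xX xp po {nesc} => [|z p IH] x xX /=.
    by move=> _ xo; move: xX; rewrite xo oX.
  case/andP => xz zp pz; have [zX|zX] := boolP (z \in X).
    by exists x, z; split => //; exact: reach_start.
  have [u [w [zu wX uw]]] := IH z zX zp pz; exists u, w; split => //.
  by apply: reach_trans zu; exact: reach_step (reach_start xX) xz zX.
exists u => /=; last exact: reach_sym.
split; last by move=> /(escapes_reach xu).
apply/bigfcupP; exists w; first by rewrite wX.
by rewrite in_neighbours adj_sym.
Qed.

Lemma in_hull X x : X != fset0 -> (x \in hull X) = ~~ `[< escapes X x >].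
Proof.
move=> X0; rewrite /hull in_fset_set; last exact: hull_finite.
apply/idP/idP => [/set_mem nx|nx]; first by apply/negP => /asboolP.
by apply/mem_set => /=; move/asboolP: nx.
Qed.

Lemma notin_hull X x : X != fset0 -> x \notin hull X <-> escapes X x.
Proof. by move=> X0; rewrite in_hull // negbK; split=> /asboolP. Qed.

Lemma sub_hull X : X != fset0 -> X `<=` hull X.
Proof.
move=> X0; apply/fsubsetP => x xX; rewrite in_hull //.
by apply/asboolP => /escapes_notin; rewrite xX.
Qed.

Lemma hull_boundary X x y : X != fset0 ->
  x \in hull X -> adj x y -> y \notin hull X -> x \in X.
Proof.
move=> X0 xH xy /(notin_hull _ X0) yesc; apply: contraLR xH => xX.
apply/notin_hull => //; apply: (escapes_reach _ yesc).
exact: reach_step (reach_start xX) xy (escapes_notin yesc).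
Qed.

Lemma escapes_hull X x : X != fset0 -> escapes X x -> escapes (hull X) x.
Proof.
move=> X0 esc fin; apply: (esc); apply: sub_finite_set fin => y /= xy.
have nin z : reach X x z -> z \notin hull X.
  by move=> /reach_sym xz; apply/notin_hull => //; apply: escapes_reach xz esc.
elim: xy => [xX|u w xu IH uw wX]; first by apply/reach_start/nin/reach_start.
exact: reach_step IH uw (nin _ (reach_step xu uw wX)).
Qed.

(** Deleting v splits its infinite component off W into finitely many pieces,
    one of which is infinite. *)
Lemma escapes_neighbour W v : escapes W v ->
  exists2 w, adj v w & escapes (v |` W) w.
Proof.
move=> esc; apply: contrapT => H; apply: esc.
apply: (@sub_finite_set _ _ ([set v] `|`
  \bigcup_(w in [set` neighbours v]) [set y | reach (v |` W)%fset w y])%classic).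
  move=> y /=; elim=> [_|u w _ [->|[z vz zu]] uw wW]; first by left.
    have [->|wv] := eqVneq w v; [by left|right; exists w => /=].
      by rewrite in_neighbours.
    by apply: reach_start; rewrite in_fsetU in_fset1 negb_or wv.
  have [->|wv] := eqVneq w v; [by left|right; exists z => //=].
  by apply: (reach_step zu uw); rewrite in_fsetU in_fset1 negb_or wv.
rewrite finite_setU; split; first exact: finite_set1.
apply: bigcup_finite; first exact: finite_fset.
move=> w /= vw; apply: contrapT => wesc; apply: H; exists w => //.
by rewrite -in_neighbours.
Qed.

(** The number of continuations that do not trap a walk standing at v and
    confined to the complement of W. *)
Definition ways_out (W : {fset V}) (v : V) : nat :=
  count (fun w => w \notin hull (v |` W)) (neighbours v).

Lemma fset1U_neq0 (v : V) (W : {fset V}) : v |` W != fset0.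
Proof. by apply/fset0Pn; exists v; rewrite fset1U1. Qed.

Lemma ways_out_gt0 W v : escapes W v -> 0 < ways_out W v.
Proof.
case/escapes_neighbour => w vw wesc; rewrite -has_count; apply/hasP; exists w.
  by rewrite in_neighbours.
by apply/notin_hull => //; exact: fset1U_neq0.
Qed.

(** With H the hull, D := H \ W and a := ways_out W v, the only edges from D to
    the outside of H start at v, whence b(D) = a + e(D, W), while
    b(H) - b(W) = a - e(D, W). The claim is then b(D) >= Delta. *)
Lemma edge_boundary_hull W v : v \notin W ->
  edge_boundary (hull (v |` W)) + Delta <= edge_boundary W + (ways_out W v).*2.
Proof.
move=> vW; set X := v |` W; set H := hull X.
have X0 : X != fset0 by exact: fset1U_neq0.
have XH : {subset X <= H} by apply/fsubsetP/sub_hull.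
have vH : v \in H by apply: XH; rewrite fset1U1.
have WH : {subset W <= H} by move=> x xW; apply: XH; rewrite fset1Ur.
set D := H `\` W.
have inD x : (x \in D) = (x \in H) && (x \notin W) by rewrite in_fsetD andbC.
have HE : H = W `|` D.
  apply/fsetP => x; rewrite in_fsetU inD.
  by have := WH x; case: (x \in W) => [->|_] //=; rewrite andbT.
have D0 : D != fset0 by apply/fset0Pn; exists v; rewrite inD vH.
have dis : [disjoint W & D].
  by apply/fdisjointP => x xW; rewrite inD xW andbF.
have bH : edge_boundary H =
    edges_to W (fun y => y \notin H) + edges_to D (fun y => y \notin H).
  by rewrite /edge_boundary {1}HE edges_toU //.
have bW : edge_boundary W =
    edges_to W (fun y => y \notin H) + edges_to W (mem D).
  apply: edges_to_split => [x y _ _|y yH] /=; last by rewrite inD (negbTE yH).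
  by rewrite inD; have := WH y; case: (y \in W) => [->|]; case: (y \in H).
have bD : edge_boundary D =
    edges_to D (fun y => y \notin H) + edges_to D (mem W).
  apply: edges_to_split => [x y _ _|y yH] /=.
    by rewrite inD; have := WH y; case: (y \in W) => [->|]; case: (y \in H).
  by apply: contra yH; exact: WH.
have eD : edges_to D (fun y => y \notin H) = ways_out W v.
  rewrite /edges_to (big_fsetD1 v) ?inD ?vH //= big_seq big1 ?addn0 // => x.
  rewrite in_fsetD1 inD => /and3P[xv xH xW]; apply/eqP; rewrite -leqn0 leqNgt.
  rewrite -has_count; apply/hasPn => y; rewrite in_neighbours => xy.
  apply/negP => /(hull_boundary X0 xH xy).
  by rewrite in_fset1U (negbTE xv) (negbTE xW).
have := edge_boundary_ge_degree D0.
rewrite bH bW bD eD (edges_to_sym D W); lia.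
Qed.

(** * Self-avoiding walks *)

(** The walks from v off W, without their starting point, enumerated by
    forbidding each vertex once it has been left. *)
Fixpoint saws (n : nat) (W : {fset V}) (v : V) : seq (seq V) :=
  if n is n'.+1 then
    [seq w :: p | w <- [seq w <- neighbours v | w \notin v |` W],
                  p <- saws n' (v |` W) w]
  else [:: [::]].

Definition nsaw n W v : nat := size (saws n W v).

Lemma mem_saws n W v p : (p \in saws n W v) =
  [&& size p == n, path adj v p, uniq (v :: p) & all (fun x => x \notin W) p].
Proof.
elim: n W v p => [|n IH] W v p /=; first by rewrite inE; case: p.
case: p => [|w p].
  by apply/negP => /allpairsPdep[w [q [_ _]]].
have -> : (w :: p \in
    [seq w :: p | w <- [seq w <- neighbours v | w \notin v |` W],
                  p <- saws n (v |` W) w]) =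
    [&& adj v w, w \notin v |` W & p \in saws n (v |` W) w].
  apply/allpairsPdep/and3P => [[w' [p' [+ + [-> ->]]]]|[vw wW pS]].
    by rewrite mem_filter in_neighbours => /andP[].
  by exists w, p; rewrite mem_filter in_neighbours wW.
rewrite IH /= eqSS !in_cons !in_fset1U.
have -> : all (fun x => x \notin v |` W) p =
    (v \notin p) && all (fun x => x \notin W) p.
  elim: p => //= x p ->; rewrite in_fset1U in_cons !negb_or (eq_sym v x).
  by case: (x != v); case: (x \in W); case: (v \in p) => //=; rewrite ?andbF.
rewrite !negb_or (eq_sym v w).
by case: (adj v w); case: (w != v); case: (w \in W); case: (size p == n);
  case: (path adj w p); case: (w \in p); case: (uniq p); case: (v \in p);
  case: (all _ p).
Qed.

Lemma uniq_saws n W v : uniq (saws n W v).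
Proof.
elim: n W v => [|n IH] W v //=; apply: allpairs_uniq_dep.
- by rewrite filter_uniq ?fset_uniq.
- by move=> w _; exact: IH.
- by move=> [w1 p1] [w2 p2] _ _ /= [-> ->].
Qed.

Lemma num_sawE n v : num_saw adj v n = nsaw n fset0 v.
Proof.
have E p : (p \in saws n fset0 v) =
    [&& size p == n, path adj v p & uniq (v :: p)].
  rewrite mem_saws (_ : all _ p) ?andbT //.
  by apply/allP => x _; rewrite in_fset0.
have fin : finite_set (self_avoiding_walks adj v n).
  by apply: sub_finite_set (finite_seq (saws n fset0 v)) => p /=; rewrite E.
apply/perm_size/uniq_perm; [exact: fset_uniq|exact: uniq_saws|].
move=> p; rewrite in_fset_set // E.
by apply/idP/idP => [/set_mem|pS] //; exact/mem_set.
Qed.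

Lemma nsawS n W v : nsaw n.+1 W v =
  \sum_(w <- neighbours v | w \notin v |` W) nsaw n (v |` W) w.
Proof.
by rewrite /nsaw /= size_allpairs_dep sumnE big_map big_filter.
Qed.

Lemma nsaw_subset n (W W' : {fset V}) v :
  {subset W <= W'} -> nsaw n W' v <= nsaw n W v.
Proof.
elim: n W W' v => [|n IH] W W' v WW' //; rewrite !nsawS.
have sub : {subset v |` W <= v |` W'}.
  by move=> x; rewrite !in_fset1U => /orP[->//|/WW' ->]; rewrite orbT.
rewrite big_mkcond [leqRHS]big_mkcond /=; apply: leq_sum => w _.
have [wW'|//] := boolP (w \notin v |` W').
by rewrite (contra (sub w) wW') IH.
Qed.

Lemma nsaw_automorphism phi n W v : graph_automorphism adj phi ->
  nsaw n (phi @` W) (phi v) = nsaw n W v.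
Proof.
move=> aut; have inj := bij_inj aut.1.
elim: n W v => [|n IH] W v //; rewrite !nsawS.
have E : phi v |` phi @` W = phi @` (v |` W).
  by rewrite imfsetU1.
rewrite E (perm_big _ (automorphism_neighbours v aut)) big_map /=.
apply: eq_big => w; first by rewrite in_automorphism_image.
by rewrite IH.
Qed.

Lemma nsaw_transitive n x y : nsaw n fset0 x = nsaw n fset0 y.
Proof.
have [phi [aut <-]] := trans x y.
by rewrite -(nsaw_automorphism n fset0 x aut) imfset0.
Qed.

(** The last n steps of a walk form a self-avoiding walk from wherever the
    first m steps end, and by transitivity it is irrelevant where that is. *)
Lemma nsaw_submul o m n W v :
  nsaw (m + n) W v <= nsaw m W v * nsaw n fset0 o.
Proof.
elim: m W v => [|m IH] W v.
  rewrite mul1n (nsaw_transitive n o v).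
  by apply: nsaw_subset => x; rewrite in_fset0.
by rewrite addSn !nsawS big_distrl /=; apply: leq_sum => w _; exact: IH.
Qed.

(** * Counting untrapped walks *)

Section LowerBound.
Local Open Scope ring_scope.
Variables (R : realType) (kappa : R).
Hypothesis Delta_ge3 : (3 <= Delta)%N.
Hypothesis kappa_ge0 : 0 <= kappa.
Hypothesis isoperimetry :
  forall A : {fset V}, kappa * #|` A|%:R <= (edge_boundary A)%:R.

(** A lower bound for the sum of a_k - 1 over the n steps of an untrapped walk,
    a_k being the number of ways out at step k: the sum of the a_k is at least
    half of Delta n + b(H) - b(W), where the final hull H has at least |W| + n
    vertices, hence b(H) >= kappa (|W| + n). *)
Definition saw_exponent (n : nat) (W : {fset V}) : R :=
  (Delta%:R * n%:R + kappa * (#|` W| + n)%:R - (edge_boundary W)%:R) / 2 - n%:R.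

(** Induction on n, choosing the next vertex w among the ways out and replacing
    W by the hull of v |` W. The neighbour of v in W is the vertex that the walk
    came from: it leaves at most Delta - 1 ways out, so that their number a is
    at least (Delta-1)^((a-1)/(Delta-2)). *)
Lemma nsaw_lower_bound n W v : escapes W v -> (exists2 u, u \in W & adj v u) ->
  (Delta%:R - 1) `^ (saw_exponent n W / (Delta%:R - 2)) <= (nsaw n W v)%:R :> R.
Proof.
have D3 : 3 <= Delta%:R :> R by rewrite (ler_nat _ 3).
elim: n W v => [|n IH] W v vesc [u uW vu].
  rewrite -[leRHS](@powRr0 R (Delta%:R - 1)); apply: ler_powR; first lra.
  rewrite /saw_exponent addn0 pmulr_lle0 ?invr_gt0; last by lra.
  by have := isoperimetry W; lra.
set X := v |` W; set H := hull X.
have X0 : X != fset0 by exact: fset1U_neq0.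
have XH : {subset X <= H} by apply/fsubsetP/sub_hull.
have vX : v \in X by rewrite fset1U1.
have uH : u \in H by apply: XH; rewrite fset1Ur.
set a := ways_out W v.
have a_gt0 : 1 <= a%:R :> R by rewrite (ler_nat _ 1) ways_out_gt0.
have a_le : a%:R <= Delta%:R - 1 :> R.
  rewrite lerBrDr natr1 ler_nat -(size_neighbours v) -(count_predC (mem H)).
  rewrite addnC -addn1 leq_add2l -has_count.
  by apply/hasP; exists u; rewrite ?in_neighbours.
have bdH := edge_boundary_hull (escapes_notin vesc).
have cardH : (#|` W|.+1 <= #|` H|)%N.
  apply: leq_trans (fsubset_leq_card (sub_hull X0)).
  by rewrite cardfsU1 escapes_notin.
have step : (Delta%:R - 1) `^ (saw_exponent n H / (Delta%:R - 2)) * a%:R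
    <= (nsaw n.+1 W v)%:R :> R.
  apply: (@le_trans _ _ (\sum_(w <- neighbours v | w \notin H) nsaw n H w)%:R).
    rewrite natr_sum mulr_natr -iter_addr_0 -big_const_seq.
    rewrite big_seq_cond [leRHS]big_seq_cond; apply: ler_sum => w.
    rewrite in_neighbours => /andP[vw wH]; apply: IH.
      by apply: escapes_hull => //; apply/notin_hull.
    by exists v; [exact: XH|rewrite adj_sym].
  rewrite ler_nat nsawS big_mkcond [leqRHS]big_mkcond /=; apply: leq_sum => w _.
  have [wH|//] := boolP (w \notin H).
  by rewrite (contra (XH w) wH) nsaw_subset.
apply: le_trans step.
have frac : (Delta%:R - 1) `^ ((a%:R - 1) / (Delta%:R - 2)) <= a%:R :> R.
  have := @powR_bernoulli R (Delta%:R - 2) ((a%:R - 1) / (Delta%:R - 2)).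
  rewrite divfK; last by rewrite gt_eqF //; lra.
  rewrite (_ : 1 + (Delta%:R - 2) = Delta%:R - 1); last ring.
  rewrite (_ : 1 + (a%:R - 1) = a%:R); last ring.
  apply; first by lra.
  by rewrite divr_ge0 ?ler_pdivrMr; lra.
apply: le_trans (ler_wpM2l (powR_ge0 _ _) frac).
rewrite -powRD; last first.
  by apply/implyP => _; rewrite gt_eqF //; lra.
apply: ler_powR; first lra.
rewrite -mulrDl ler_pM2r ?invr_gt0; last lra.
rewrite /saw_exponent.
have : (edge_boundary H)%:R + Delta%:R <= (edge_boundary W)%:R + a%:R * 2 :> R.
  by rewrite -natrM -!natrD ler_nat muln2.
have : kappa * (#|`W| + n.+1)%:R <= kappa * (#|` H| + n)%:R.
  by rewrite ler_wpM2l // ler_nat addnS -addSn leq_add2r.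
rewrite -[n.+1]addn1 !natrD; lra.
Qed.

(** At the first step there may be Delta ways out, so the lower bound is applied
    from the second vertex on; this only affects the constant C. *)
Lemma nsaw_growth o : exists C : R, forall n,
  (Delta%:R - 1) `^ (1 / 2 * (1 + kappa / (Delta%:R - 2)) * n%:R - C)
    <= (nsaw n fset0 o)%:R :> R.
Proof.
have D3 : 3 <= Delta%:R :> R by rewrite (ler_nat _ 3).
set E := 1 / 2 * _.
have E0 : 0 <= E by rewrite mulr_ge0 // addr_ge0 // divr_ge0 //; lra.
have oesc : escapes fset0 o.
  move=> fin; apply: V_inf; apply: sub_finite_set fin => y _ /=.
  have [p [op <-]] := conn o y.
  elim/last_ind: p op => [_|p z IH]; first exact: reach_start.
  by rewrite rcons_path last_rcons => /andP[/IH op oz]; exact: reach_step op oz _.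
have [w ow /(escapes_hull (fset1U_neq0 o fset0)) wesc] := escapes_neighbour oesc.
set H := hull _ in wesc.
have oH : o \in H.
  by apply: (fsubsetP (sub_hull (fset1U_neq0 _ _))); rewrite fset1U1.
have H_exp n : saw_exponent n H / (Delta%:R - 2) =
    E * n%:R - ((edge_boundary H)%:R - kappa * #|` H|%:R) / 2 / (Delta%:R - 2).
  by rewrite /saw_exponent natrD /E; field; rewrite gt_eqF //; lra.
set C := (_ / 2 / (Delta%:R - 2)) in H_exp.
have C0 : 0 <= C by rewrite divr_ge0 ?divr_ge0 ?subr_ge0 ?isoperimetry //; lra.
exists (C + E) => -[|n].
  by rewrite -[leRHS](@powRr0 R (Delta%:R - 1)); apply: ler_powR; lra.
have : (nsaw n H w <= nsaw n.+1 fset0 o)%N.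
  rewrite nsawS (@leq_trans (nsaw n (o |` fset0) w)) //.
    by apply: nsaw_subset; apply/fsubsetP/sub_hull/fset1U_neq0.
  have w_new : w \notin o |` fset0.
    by rewrite in_fset1U in_fset0 orbF; apply: contraTneq ow => ->; rewrite adj_irr.
  by rewrite big_mkcond (big_fsetD1 w) /= ?in_neighbours // w_new leq_addr.
rewrite -(ler_nat R); apply: le_trans; apply: le_trans (nsaw_lower_bound n wesc _).
  by rewrite H_exp; apply: ler_powR; [lra|rewrite -[n.+1]addn1 natrD; lra].
by exists o; rewrite ?oH // adj_sym.
Qed.
End LowerBound.
End Regular.
End Graph.

(** * The connective constant *)

Theorem theorem6p2 (R : realType) (V : choiceType) (adj : rel V)
    (adj_sym : symmetric adj) (adj_irr : irreflexive adj)
    (V_inf : infinite_set [set: V])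
    (G_locfin : locally_finite adj)
    (G_conn : connected_graph adj)
    (G_trans : vertex_transitive adj)
    (Delta : nat) (Delta_ge3 : (3 <= Delta)%N)
    (G_deg : forall x, degree adj x = Delta)
    (o : V) (lam : R)
    (lam_bottom :
      is_spectral_bottom (fun f : V -> R => f \- srw_op adj f) lam) :
  let c : R := Delta%:R * (Delta%:R - 1) / (Delta%:R - 2) ^+ 2 in
  (Delta%:R - 1) `^ (1 / 2 * (1 + c * lam)) <= connective_constant adj R o.
Proof.
cbv zeta; set c : R := Delta%:R * _ / _.
have D3 : 3 <= Delta%:R :> R by rewrite (ler_nat _ 3).
(* The isoperimetric inequality requires a nonnegative bound; it is trivial
   for the bound 0, and enlarging lam strengthens the conclusion. *)
pose lam' := Num.max lam 0.
pose kappa := lam' * (Delta%:R * (Delta%:R - 1) / (Delta%:R - 2)).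
have lam'0 : 0 <= lam' by rewrite /lam' le_max lexx orbT.
have kappa0 : 0 <= kappa by rewrite mulr_ge0 ?divr_ge0 ?mulr_ge0 //; lra.
have iso (A : {fset V}) : kappa * #|` A|%:R <= (edge_boundary adj A)%:R.
  rewrite /kappa /lam'; have [lam0|lam0] := leP lam 0; first by rewrite !mul0r.
  by apply: spectral_isoperimetry => //; [exact: lam_bottom.1|exact: ltW].
have [C growth] := nsaw_growth adj_sym G_locfin G_deg adj_irr V_inf G_conn
  G_trans Delta_ge3 kappa0 iso o.
apply: (@le_trans _ _ ((Delta%:R - 1) `^ (1 / 2 * (1 + kappa / (Delta%:R - 2))))).
  apply: ler_powR; first lra.
  rewrite ler_pM2l ?lerD2l; last lra.
  rewrite (_ : kappa / _ = c * lam'); last first.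
    by rewrite /kappa /c; field; rewrite gt_eqF //; lra.
  rewrite ler_wpM2l ?le_max ?lexx // /c divr_ge0 ?sqr_ge0 // mulr_ge0 //; lra.
rewrite /connective_constant.
under eq_fun do rewrite num_sawE //.
apply: (@root_limit_ge _ (fun n => nsaw adj n fset0 o) _ _ C _ _ _ growth).
- by lra.
- move=> n; rewrite -(ltr_nat R); apply: lt_le_trans (growth n).
  by rewrite powR_gt0 //; lra.
- by move=> m n; exact: nsaw_submul.
Qed.
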